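(* Let $n > 3$ be an integer, let $p_i$ denote the $i$th prime number, and let $\pi(x)$ denote the prime counting function. Then $n$ is prime if and only if $$\sum_{i=1}^{\pi(\sqrt{n})} \left( \binom{n+p_i-1}{n-1} \bmod n \right) = 0.$$
   Context: The primes are listed in increasing order, $p_1 = 2, p_2 = 3, p_3 = 5, \dots$; $\pi(x)$ is the number of primes less than or equal to the real number $x$. For an integer $a$ and a positive integer $m$, $a \bmod m$ denotes the remainder in $\{0,1,\dots,m-1\}$ of $a$ upon division by $m$. The sum is a sum of remainders, taken as an ordinary sum of nonnegative integers. *)

(* Defs.v *)
From mathcomp Require Import all_boot all_order all_algebra.
From mathcomp Require Import finmap.
From mathcomp Require Import boolp classical_sets cardinality reals.

Set Implicit Arguments.
Unset Strict Implicit.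
Unset Printing Implicit Defensive.

Import Order.TTheory GRing.Theory Num.Theory.

Lemma exists_prime_gt (m : nat) : exists p, (m < p) && prime p.
Proof. by have [p ltmp pr_p] := prime_above m; exists p; rewrite ltmp. Qed.

Definition next_prime (m : nat) : nat := ex_minn (exists_prime_gt m).

(* Indexing starts at 1: nth_prime 1 = 2, nth_prime 2 = 3, nth_prime 3 = 5;
   nth_prime 0 = 0 is not a prime and only starts the recursion. *)
Definition nth_prime (i : nat) : nat := iter i next_prime 0.

(* [fset_set] of an infinite set would be empty, but the set below is always
   finite. *)
Definition prime_pi (R : realType) (x : R) : nat :=
  #|` fset_set [set p : nat | prime p /\ (p%:R <= x)%R]%classic|%fset.

(* Main.v *)
Require Import Defs.
From mathcomp Require Import all_boot all_order all_algebra.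
From mathcomp Require Import finmap.
From mathcomp Require Import boolp classical_sets cardinality reals.

Set Implicit Arguments.
Unset Strict Implicit.
Unset Printing Implicit Defensive.

Import GRing.Theory Num.Theory.

(** Everything rests on [p * C(n + p - 1, p) = n * C(n + p - 1, p - 1)]
    ([mul_bin_addn_pred]), where [C(n + p - 1, p) = C(n + p - 1, n - 1)].  If
    [n] is prime and [0 < p < n], then [n] is coprime to [p] and so divides
    [C(n + p - 1, p)]: every remainder vanishes.  If [p] is a prime factor of
    [n], the identity shows that [n] divides [C(n + p - 1, p)] only if [p]
    divides [C(n + p - 1, p - 1)]; this fails, because no factor of the
    numerator [(n + 1) ... (n + p - 1)] is a multiple of [p]
    ([prime_ndvd_bin]).  The least prime factor [p] of a composite [n] satisfies
    [p ^ 2 <= n], so its remainder is a nonzero term of the sum.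

    It remains to see that the indices [1 <= i <= pi(sqrt n)] enumerate exactly
    the primes up to [sqrt n].  On the primes, the counting function is strictly
    increasing, hence injective, and [nth_prime] is a right inverse of it
    ([prime_count_nth_prime]); so it is also a left inverse on the primes
    ([nth_prime_count]), and comparing indices amounts to comparing primes
    ([leq_prime_countE]). *)

Definition prime_count (m : nat) : nat := count prime (iota 0 m.+1).

Lemma prime_countS (m : nat) : prime_count m.+1 = prime_count m + prime m.+1.
Proof. by rewrite /prime_count -(addn1 m.+1) iotaD count_cat /= addn0. Qed.

Lemma leq_prime_count (m n : nat) : m <= n -> prime_count m <= prime_count n.
Proof.
elim: n => [|n IHn]; first by rewrite leqn0 => /eqP ->.
rewrite leq_eqVlt => /predU1P[-> // | /IHn le_mn].
by rewrite prime_countS (leq_trans le_mn) ?leq_addr.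
Qed.

Lemma ltn_prime_count (m p : nat) :
  prime p -> m < p -> prime_count m < prime_count p.
Proof.
case: p => // p pr_p lt_mp.
by rewrite prime_countS pr_p addn1 ltnS leq_prime_count.
Qed.

Lemma leq_prime_countE (m p : nat) :
  prime p -> (prime_count p <= prime_count m) = (p <= m).
Proof.
move=> pr_p; apply/idP/idP; last exact: leq_prime_count.
by apply: contraLR; rewrite -!ltnNge; apply: ltn_prime_count.
Qed.

Lemma prime_count_gt0 (p : nat) : prime p -> 0 < prime_count p.
Proof. by move=> pr_p; apply: (@ltn_prime_count 0 p pr_p (prime_gt0 pr_p)). Qed.

Lemma prime_count_inj : {in prime &, injective prime_count}.
Proof.
move=> p q pr_p pr_q eq_pq; apply/eqP.
by rewrite eqn_leq -(leq_prime_countE _ pr_p) -(leq_prime_countE _ pr_q) eq_pq leqnn.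
Qed.

Lemma nth_prime_prime (i : nat) : 0 < i -> prime (nth_prime i).
Proof.
case: i => // i _; rewrite /nth_prime iterS /next_prime.
by case: ex_minnP => p /andP[].
Qed.

Lemma prime_count_next_prime (m : nat) :
  prime_count (next_prime m) = (prime_count m).+1.
Proof.
rewrite /next_prime; case: ex_minnP => -[|p] /andP[lt_mp pr_p] min_p //.
rewrite prime_countS pr_p addn1; congr _.+1.
(* By minimality of [p + 1] there is no prime in [m + 1 .. p], so the count is constant there. *)
have: forall k, m <= k <= p -> prime_count k = prime_count m.
  elim=> [|k IHk]; first by rewrite leqn0 => /andP[/eqP ->].
  case/andP; rewrite leq_eqVlt => /predU1P[-> // | lt_mk lt_kp].
  rewrite prime_countS IHk; last by rewrite -ltnS lt_mk ltnW.
  case: (boolP (prime k.+1)) => [pr_k|_]; last by rewrite addn0.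
  by have := min_p k.+1; rewrite lt_mk pr_k ltnNge lt_kp => /(_ isT).
by apply; rewrite -ltnS lt_mp leqnn.
Qed.

Lemma prime_count_nth_prime (i : nat) : prime_count (nth_prime i) = i.
Proof. by elim: i => // i IHi; rewrite /nth_prime iterS prime_count_next_prime IHi. Qed.

Lemma nth_prime_count (p : nat) : prime p -> nth_prime (prime_count p) = p.
Proof.
move=> pr_p; apply: prime_count_inj => //; last exact: prime_count_nth_prime.
by apply: nth_prime_prime; apply: prime_count_gt0.
Qed.

Lemma prime_piE (R : realType) (x : R) :
  (0 <= x)%R -> prime_pi x = prime_count (Num.truncn x).
Proof.
move=> x_ge0; set s := [seq p <- iota 0 (Num.truncn x).+1 | prime p].
rewrite /prime_pi /prime_count -size_filter -/s.
have -> : [set p : nat | prime p /\ (p%:R <= x)%R]%classic = [set` s]%classic.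
  apply/seteqP; split=> p /=; rewrite mem_filter mem_iota /= add0n ltnS;
    by rewrite truncn_ge_nat // => /andP.
apply: perm_size; apply: uniq_perm => [||p].
- exact: fset_uniq.
- by rewrite filter_uniq ?iota_uniq.
by rewrite in_fset_set ?mem_setE //; apply: finite_seq.
Qed.

Lemma leq_truncn_sqrt (R : realType) (n p : nat) :
  (p <= Num.truncn (Num.sqrt (n%:R : R)%R)) = (p ^ 2 <= n).
Proof.
rewrite truncn_ge_nat ?sqrtr_ge0 //.
rewrite -(ler_nat R) natrX -{2}(@sqr_sqrtr R n%:R)%R ?ler0n //.
by rewrite ler_pXn2r // nnegrE ?sqrtr_ge0 ?ler0n.
Qed.

(** With [m = n + p - 1], this is the step [p * C(m, p) = (m - p + 1) * C(m, p - 1)]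
    along a row of Pascal's triangle, since [m - p + 1 = n]. *)
Lemma mul_bin_addn_pred (n p : nat) : 0 < n -> 0 < p ->
  p * 'C(n + p - 1, n - 1) = n * 'C(n + p - 1, p - 1).
Proof.
case: n p => [|n] [|p] // _ _.
rewrite !subn1 addSn /= -(@bin_sub (n + p.+1) n) ?leq_addr // addKn.
by rewrite addnS mul_bin_left subSn ?leq_addl // addnK.
Qed.

(** [n] divides [p * C(n + p - 1, n - 1)] and is coprime to [p]. *)
Lemma prime_dvd_bin_addn_pred (n p : nat) :
  prime n -> 0 < p < n -> n %| 'C(n + p - 1, n - 1).
Proof.
move=> pr_n /andP[p_gt0 lt_pn].
have co_np : coprime n p by rewrite prime_coprime // gtnNdvd.
rewrite -(Gauss_dvdr _ co_np) mul_bin_addn_pred // ?prime_gt0 //.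
exact: dvdn_mulr.
Qed.

(** The factors [n + 1, ..., n + p - 1] of the numerator lie strictly between
    two consecutive multiples of [p]. *)
Lemma prime_ndvd_bin (n p : nat) :
  prime p -> p %| n -> ~~ (p %| 'C(n + p - 1, p - 1)).
Proof.
move=> pr_p p_dv_n; apply/negP => /(dvdn_mulr (p - 1)`!).
rewrite bin_ffact ffact_prod Euclid_dvd_prod // big_orE => /existsP[i] /=.
have p_gt0 := prime_gt0 pr_p; have lt_i := ltn_ord i.
rewrite -addnBA // -addnBA 1?ltnW // dvdn_addr // gtnNdvd ?subn_gt0 //.
by rewrite (leq_ltn_trans (leq_subr _ _)) // ltn_subrL.
Qed.

(** If [n] divided the coefficient, then [n * p] would divide
    [p * C(n + p - 1, n - 1) = n * C(n + p - 1, p - 1)]; cancelling [n]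
    contradicts [prime_ndvd_bin]. *)
Lemma ndvd_bin_addn_pred (n p : nat) :
  0 < n -> prime p -> p %| n -> ~~ (n %| 'C(n + p - 1, n - 1)).
Proof.
move=> n_gt0 pr_p p_dv_n; apply: contra (prime_ndvd_bin pr_p p_dv_n).
move=> n_dv; rewrite -(dvdn_pmul2l n_gt0) -mul_bin_addn_pred // ?prime_gt0 //.
by rewrite mulnC dvdn_mul.
Qed.

Theorem theorem2p2 (R : realType) (n : nat) (n_gt3 : 3 < n) :
  prime n <->
  \sum_(1 <= i < (prime_pi (Num.sqrt (n%:R : R)%R)).+1)
     ('C(n + nth_prime i - 1, n - 1) %% n) = 0.
Proof.
have n_gt0 : 0 < n by apply: leq_trans n_gt3.
rewrite prime_piE ?sqrtr_ge0 //.
split=> [pr_n | sum0].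
  rewrite big_nat big1 // => i /andP[i_gt0]; rewrite ltnS => le_is.
  have pr_p := nth_prime_prime i_gt0.
  apply/eqP; apply: prime_dvd_bin_addn_pred => //; rewrite prime_gt0 //=.
  (* As [i] is the number of primes up to [nth_prime i], the bound on [i]
     bounds [nth_prime i] by [sqrt n]. *)
  rewrite -{}[i]prime_count_nth_prime leq_prime_countE // in le_is.
  rewrite leq_truncn_sqrt in le_is; apply: leq_trans le_is.
  by rewrite -{1}[nth_prime i]expn1 ltn_exp2l ?prime_gt1.
case: (boolP (prime n)) => // npr_n.
have n_gt1 : 1 < n by apply: leq_trans n_gt3.
have pr_p := pdiv_prime n_gt1.
have le_p2 : pdiv n ^ 2 <= n.
  by rewrite leqNgt; apply: contra npr_n => /ltn_pdiv2_prime ->.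
have := ndvd_bin_addn_pred n_gt0 pr_p (pdiv_dvd n).
case/negP; rewrite /dvdn -{1}(nth_prime_count pr_p).
move/eqP: sum0; rewrite sum_nat_seq_eq0 => /allP /= /(_ (prime_count (pdiv n))).
rewrite mem_index_iota prime_count_gt0 // ltnS leq_prime_countE //.
by rewrite leq_truncn_sqrt le_p2; apply.
Qed.
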